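(* Let $p\in[0,1]$ satisfy $p\ge_T\emptyset'$. Then there is $y\notin\mathsf{MLR}_{\mu_p}$ and a constant $c$ such that $\mathit{KA}(y\upharpoonright n)\ge-\log\mu_p(y\upharpoonright n)-c$ for all $n$.
   Context: For $p\in[0,1]$ the Bernoulli measure $\mu_p$ on $2^\omega$ is determined by $\mu_p(\sigma)=p^{\#_0(\sigma)}(1-p)^{\#_1(\sigma)}$, where $\#_i(\sigma)$ is the number of occurrences of $i$ in $\sigma$; $p$ is identified with its binary expansion. $\mathsf{MLR}_{\mu_p}$ is the set of sequences Martin-Löf random for $\mu_p$ relative to oracle $p$. A semimeasure is $\rho:2^{<\omega}\to[0,1]$ with $\rho(\emptyset)\le1$ and $\rho(\sigma)\ge\rho(\sigma0)+\rho(\sigma1)$; it is left-c.e. if its values are uniformly limits of computable nondecreasing sequences of rationals. $M$ is a universal left-c.e. semimeasure (for every left-c.e. semimeasure $\rho$ there is $c>0$ with $M\ge c\rho$), and the a priori complexity is $\mathit{KA}(\sigma)=-\log M(\sigma)$ (unrelativized). $y\upharpoonright n$ is the length-$n$ prefix of $y$. *)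

(* Defs.v *)
From Stdlib Require Import Reals List Lra.
Import ListNotations.
Open Scope R_scope.

Definition cpair (x y : nat) : nat :=
  (Nat.div ((x + y) * (x + y + 1)) 2 + y)%nat.

Inductive instr : Type :=
  | Inc : nat -> instr
  | Dec : nat -> nat -> instr
  | Orc : nat -> instr.

Definition program := list instr.
Definition oracle := nat -> bool.
Definition empty_oracle : oracle := fun _ => false.

Definition upd (f : nat -> nat) (r v : nat) : nat -> nat :=
  fun k => if Nat.eqb k r then v else f k.

Fixpoint run_aux (P : program) (A : oracle) (fuel : nat)
         (regs : nat -> nat) (pc : nat) : option nat :=
  match nth_error P pc with
  | None => Some (regs O)
  | Some i =>
      match fuel with
      | O => None
      | S f =>
          match i with
          | Inc r => run_aux P A f (upd regs r (S (regs r))) (S pc)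
          | Dec r j =>
              match regs r with
              | O => run_aux P A f regs j
              | S m => run_aux P A f (upd regs r m) (S pc)
              end
          | Orc r => run_aux P A f (upd regs r (if A (regs r) then 1%nat else 0%nat)) (S pc)
          end
      end
  end.

Definition run (P : program) (A : oracle) (fuel x : nat) : option nat :=
  run_aux P A fuel (fun k => if Nat.eqb k 0 then x else 0%nat) 0%nat.

Definition halts_with (P : program) (A : oracle) (x v : nat) : Prop :=
  exists s, run P A s x = Some v.

Definition halts (P : program) (A : oracle) (x : nat) : Prop :=
  exists s v, run P A s x = Some v.

Definition enc_instr (i : instr) : nat :=
  match i with
  | Inc r => (3 * r)%nat
  | Dec r j => (3 * cpair r j + 1)%nat
  | Orc r => (3 * r + 2)%nat
  end.

Fixpoint enc_prog (P : program) : nat :=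
  match P with
  | [] => O
  | i :: Q => S (cpair (enc_instr i) (enc_prog Q))
  end.

Definition halting_le_T (A : oracle) : Prop :=
  exists D : program, forall (Q : program) (x : nat),
    (halts Q empty_oracle x -> halts_with D A (cpair (enc_prog Q) x) 1%nat) /\
    (~ halts Q empty_oracle x -> halts_with D A (cpair (enc_prog Q) x) 0%nat).

Definition bstring := list bool.

Fixpoint scode (s : bstring) : nat :=
  match s with
  | [] => O
  | b :: t => (2 * scode t + 1 + (if b then 1 else 0))%nat
  end.

Fixpoint count0 (s : bstring) : nat :=
  match s with [] => O | b :: t => ((if b then 0 else 1) + count0 t)%nat end.
Fixpoint count1 (s : bstring) : nat :=
  match s with [] => O | b :: t => ((if b then 1 else 0) + count1 t)%nat end.

Definition prefix (y : nat -> bool) (n : nat) : bstring := map y (seq 0 n).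

Definition is_prefix (s t : bstring) : Prop := exists u, t = s ++ u.
Definition incomparable (s t : bstring) : Prop := ~ is_prefix s t /\ ~ is_prefix t s.

(* Decoding of naturals as rationals (computably): n = <a,b>, with a the
   zigzag code of an integer numerator and b+1 the denominator. *)
Definition zigzag (a : nat) : R :=
  if Nat.even a then INR (Nat.div a 2) else - INR (Nat.div (S a) 2).
Definition qval (a b : nat) : R := zigzag a / INR (S b).

Definition mu (p : R) (s : bstring) : R := p ^ count0 s * (1 - p) ^ count1 s.

Fixpoint bsum (b : nat -> bool) (n : nat) : R :=
  match n with
  | O => 0
  | S k => bsum b k + (if b k then (/2) ^ (S k) else 0)
  end.
Definition binary_expansion (b : nat -> bool) (p : R) : Prop :=
  Un_cv (bsum b) p.

Definition semimeasure (rho : bstring -> R) : Prop :=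
  (forall s, 0 <= rho s <= 1) /\ rho [] <= 1 /\
  (forall s, rho (s ++ [false]) + rho (s ++ [true]) <= rho s).

Definition left_ce (rho : bstring -> R) : Prop :=
  exists (P : program) (a b : bstring -> nat -> nat),
    (forall s t, halts_with P empty_oracle (cpair (scode s) t) (cpair (a s t) (b s t))) /\
    (forall s t, qval (a s t) (b s t) <= qval (a s (S t)) (b s (S t))) /\
    (forall s, Un_cv (fun t => qval (a s t) (b s t)) (rho s)).

Definition universal_lce_semimeasure (M : bstring -> R) : Prop :=
  semimeasure M /\ left_ce M /\
  forall rho, semimeasure rho -> left_ce rho ->
    exists c, 0 < c /\ forall s, c * rho s <= M s.

Definition log2 (x : R) : R := ln x / ln 2.

Definition KA (M : bstring -> R) (s : bstring) : R := - log2 (M s).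

(* The test is the uniformly b-c.e. family U_n = { sigma | P^b halts on <n, code sigma> }. *)
Definition test_set (P : program) (A : oracle) (n : nat) (s : bstring) : Prop :=
  halts P A (cpair n (scode s)).

Fixpoint sum_mu (p : R) (F : list bstring) : R :=
  match F with [] => 0 | s :: G => mu p s + sum_mu p G end.

(* mu_p([U_n]) <= 2^{-n}: the measure of the open set [U_n] is the supremum of
   the measures of finite disjoint (prefix-free) unions of cylinders from U_n. *)
Definition ML_test (p : R) (A : oracle) (P : program) : Prop :=
  forall (n : nat) (F : list bstring),
    ForallOrdPairs incomparable F ->
    (forall s, In s F -> test_set P A n s) ->
    sum_mu p F <= (/2) ^ n.

Definition MLR (p : R) (A : oracle) (y : nat -> bool) : Prop :=
  ~ exists P : program, ML_test p A P /\
      forall n, exists k, test_set P A n (prefix y k).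

(* Main.v *)
(** The oracle b computes a sequence y along which a rational product measure r, with r <= C * mu_p,
    dominates M.  Let p_n be the n-bit truncation of p and let r (s0) = r s * p_n and
    r (s1) = r s * (1 - p_n) for |s| = n.  As M (s0) + M (s1) <= M s <= r s, one child of s satisfies
    the same bound; y takes the child s1 exactly when M (s0) > r (s0).  This is a Sigma_1 question,
    since M is left-c.e. and r (s0) is a rational obtained from b, so it is decided from b >=_T 0'.
    Hence M <= C * mu_p along y.  Moreover y is computable in b and has exponentially decreasing
    mu_p-measure along its prefixes, so for some d the singletons U_n = { y | dn } form a
    Martin-Löf test.
    For p in {0, 1} the constant sequence of the null bit works, because its prefixes are null and
    [log2 0 = 0].  For 0 < p < 1, on the contrary, KA is meaningful only because M > 0, which
    universality gives by comparison with a positive computable semimeasure. *)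
Require Import Defs.
From Stdlib Require Import Reals List Lia Lra Arith FunctionalExtensionality ClassicalEpsilon.
Import ListNotations.
Open Scope nat_scope.

(** * Structured programs for the oracle machine *)

Definition exec (A : oracle) (i : instr) (c : (nat -> nat) * nat) : (nat -> nat) * nat :=
  let (s, pc) := c in
  match i with
  | Inc r => (upd s r (S (s r)), S pc)
  | Dec r j => match s r with O => (s, j) | S m => (upd s r m, S pc) end
  | Orc r => (upd s r (if A (s r) then 1 else 0), S pc)
  end.

Inductive steps (P : program) (A : oracle) :
  nat -> (nat -> nat) * nat -> (nat -> nat) * nat -> Prop :=
| steps_O c : steps P A 0 c c
| steps_S n i s pc c' : nth_error P pc = Some i ->
    steps P A n (exec A i (s, pc)) c' -> steps P A (S n) (s, pc) c'.

Lemma run_aux_S P A f s pc i : nth_error P pc = Some i ->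
  run_aux P A (S f) s pc =
  run_aux P A f (fst (exec A i (s, pc))) (snd (exec A i (s, pc))).
Proof.
  intros H; simpl; rewrite H; destruct i; simpl; auto.
  destruct (s n); reflexivity.
Qed.

Lemma steps_trans P A n m c1 c2 c3 :
  steps P A n c1 c2 -> steps P A m c2 c3 -> steps P A (n + m) c1 c3.
Proof.
  induction 1; intros H2; simpl; auto. econstructor; eauto.
Qed.

Lemma steps_one P A i s pc : nth_error P pc = Some i ->
  steps P A 1 (s, pc) (exec A i (s, pc)).
Proof. intros H; econstructor; eauto; constructor. Qed.

Lemma run_aux_steps P A n c c' f : steps P A n c c' ->
  run_aux P A (n + f) (fst c) (snd c) = run_aux P A f (fst c') (snd c').
Proof.
  induction 1; auto. simpl fst; simpl snd.
  change (S n + f) with (S (n + f)). erewrite run_aux_S; eauto.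
Qed.

Lemma run_aux_steps_inv P A n c c' f v : steps P A n c c' ->
  run_aux P A f (fst c) (snd c) = Some v ->
  n <= f /\ run_aux P A (f - n) (fst c') (snd c') = Some v.
Proof.
  intros H; revert f; induction H as [|n i s pc c' Hi Hs IH]; intros f Hf.
  - rewrite Nat.sub_0_r; split; [lia|auto].
  - destruct f as [|f]; [simpl in Hf; rewrite Hi in Hf; discriminate|].
    simpl fst in Hf; simpl snd in Hf.
    rewrite (run_aux_S _ _ _ _ _ _ Hi) in Hf. apply IH in Hf.
    split; [lia|]. exact (proj2 Hf).
Qed.

(** From a configuration in [S], a halting run would reach [S] again with strictly less fuel left,
    so strong induction on the fuel excludes it. *)
Lemma diverge P A (S : (nat -> nat) * nat -> Prop) :
  (forall c, S c -> exists n c', 0 < n /\ steps P A n c c' /\ S c') ->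
  forall f c, S c -> run_aux P A f (fst c) (snd c) = None.
Proof.
  intros H f; induction f as [f IH] using lt_wf_ind; intros c Hc.
  destruct (run_aux P A f (fst c) (snd c)) as [v|] eqn:E; auto.
  destruct (H c Hc) as (n & c' & Hn & Hst & Hc').
  destruct (run_aux_steps_inv _ _ _ _ _ _ _ Hst E) as [Hle E'].
  rewrite IH in E'; [discriminate|lia|exact Hc'].
Qed.

(** * Placing code inside a larger program *)

Definition embedded (big : program) (k : nat) (P : program) : Prop :=
  forall i ins, nth_error P i = Some ins -> nth_error big (k + i) = Some ins.

Lemma embedded_app big k P Q : embedded big k (P ++ Q) ->
  embedded big k P /\ embedded big (k + length P) Q.
Proof.
  intros H; split; intros i ins Hi.
  - apply H. rewrite nth_error_app1; auto. apply nth_error_Some; congruence.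
  - replace (k + length P + i) with (k + (length P + i)) by lia.
    apply H. rewrite nth_error_app2 by lia.
    replace (length P + i - length P) with i by lia; auto.
Qed.

(** A jump past the end of a program halts the machine. Capping the target at [len] turns such a
    halt into arrival at the first address after the block. *)
Definition reloc (B k len : nat) (i : instr) : instr :=
  match i with
  | Inc r => Inc (B + r)
  | Dec r j => Dec (B + r) (k + Nat.min j len)
  | Orc r => Orc (B + r)
  end.

Definition reg_of (i : instr) : nat :=
  match i with Inc r => r | Dec r _ => r | Orc r => r end.

Fixpoint mreg (P : program) : nat :=
  match P with [] => 1 | i :: Q => Nat.max (S (reg_of i)) (mreg Q) end.

Lemma mreg_spec P pc i : nth_error P pc = Some i -> reg_of i < mreg P.
Proof.
  revert pc; induction P as [|j P IH]; intros [|pc] H; simpl in H; cbn [mreg]; try discriminate.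
  - injection H as ->; lia.
  - apply IH in H; lia.
Qed.

Lemma mreg_pos P : 0 < mreg P.
Proof. induction P; cbn [mreg]; lia. Qed.

Lemma upd_eq s r v : upd s r v r = v.
Proof. unfold upd; rewrite Nat.eqb_refl; auto. Qed.

Lemma upd_neq s r v k : k <> r -> upd s r v k = s k.
Proof. unfold upd; intros H; apply Nat.eqb_neq in H; rewrite H; auto. Qed.

Ltac upd_cases :=
  unfold upd in *;
  repeat match goal with |- context [Nat.eqb ?a ?b] => destruct (Nat.eqb_spec a b) end;
  subst; try lia; try congruence; auto.

(** The registers from [B] on imitate those of [P], one relocated instruction per step. The final
    state is chosen before [big] and [k], so the effect of the block does not depend on its
    placement. *)
Lemma raw_steps A P B :
  forall f regs pc v, run_aux P A f regs pc = Some v ->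
  forall s, (forall i, s (B + i) = regs i) ->
  exists s', (forall big k, embedded big k (map (reloc B k (length P)) P) ->
      exists n, steps big A n (s, k + Nat.min pc (length P)) (s', k + length P)) /\
    s' B = v /\ (forall j, j < B -> s' j = s j) /\
    (forall j, B + mreg P <= j -> s' j = s j).
Proof.
  intros f; induction f as [|f IH]; intros regs pc v Hrun s Hs.
  1: assert (Hend : nth_error P pc = None)
       by (simpl in Hrun; destruct (nth_error P pc); congruence).
  2: destruct (nth_error P pc) as [i|] eqn:Hend.
  (* In both halting cases [pc] lies past the end of [P], so the relocated code is already at its
     exit. *)
  1, 3: simpl in Hrun; rewrite Hend in Hrun; injection Hrun as <-;
    apply nth_error_None in Hend; exists s; repeat split; auto;
    [intros big k _; exists 0; rewrite Nat.min_r by lia; constructor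
    | rewrite <- (Nat.add_0_r B), Hs; auto].
  rewrite (run_aux_S _ _ _ _ _ _ Hend) in Hrun.
  assert (Hlt : pc < length P) by (apply nth_error_Some; congruence).
  pose proof (mreg_spec _ _ _ Hend) as Hreg.
  assert (Hstep : exists s1, (forall k, exec A (reloc B k (length P) i) (s, k + pc) =
       (s1, k + Nat.min (snd (exec A i (regs, pc))) (length P))) /\
       (forall j, s1 (B + j) = fst (exec A i (regs, pc)) j) /\
       (forall j, j < B -> s1 j = s j) /\ (forall j, B + mreg P <= j -> s1 j = s j)).
  { assert (Hmin : forall k, k + Nat.min (S pc) (length P) = S (k + pc)) by lia.
    destruct i as [r|r j0|r]; simpl in Hreg |- *.
    - eexists; split; [intros k; rewrite Hmin; reflexivity|].
      repeat split; intros j; pose proof (Hs j); pose proof (Hs r); intros; upd_cases.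
    - rewrite (Hs r). destruct (regs r) as [|m] eqn:Er; simpl.
      + eexists; split; [reflexivity|]. auto.
      + eexists; split; [intros k; rewrite Hmin; reflexivity|].
        repeat split; intros j; pose proof (Hs j); pose proof (Hs r); intros; upd_cases.
    - rewrite (Hs r). eexists; split; [intros k; rewrite Hmin; reflexivity|].
      repeat split; intros j; pose proof (Hs j); pose proof (Hs r); intros; upd_cases. }
  destruct Hstep as (s1 & Hex & Hs1 & Hlo & Hhi).
  destruct (IH _ _ _ Hrun s1 Hs1) as (s' & Hst & Hv & Hlo' & Hhi').
  exists s'. repeat split; auto.
  - intros big k Hemb. destruct (Hst big k Hemb) as [n Hn]. exists (S n).
    rewrite Nat.min_l by lia.
    econstructor; [exact (Hemb pc _ (map_nth_error _ _ _ Hend))|].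
    rewrite Hex. exact Hn.
  - intros; rewrite Hlo', Hlo; auto.
  - intros; rewrite Hhi', Hhi; auto.
Qed.

(* [CLoop r c] is: while register r is nonzero, decrement it and run c.  [CRaw B P] runs P on the
   registers from B on. *)
Inductive cmd : Type :=
| CSkip : cmd
| CInc : nat -> cmd
| CSeq : cmd -> cmd -> cmd
| CLoop : nat -> cmd -> cmd
| CRaw : nat -> program -> cmd.

Fixpoint clen (c : cmd) : nat :=
  match c with
  | CSkip => 0
  | CInc _ => 1
  | CSeq c d => clen c + clen d
  | CLoop _ c => S (clen c + 1)
  | CRaw _ P => length P
  end.

(* Register 1 is kept at 0, so [Dec 1 k] is an unconditional jump. *)
Fixpoint compile (k : nat) (c : cmd) : program :=
  match c with
  | CSkip => []
  | CInc r => [Inc r]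
  | CSeq c d => compile k c ++ compile (k + clen c) d
  | CLoop r c => Dec r (k + S (clen c + 1)) :: compile (S k) c ++ [Dec 1 k]
  | CRaw B P => map (reloc B k (length P)) P
  end.

Lemma compile_length c : forall k, length (compile k c) = clen c.
Proof.
  induction c; intros k; simpl; auto.
  - rewrite length_app, IHc1, IHc2; auto.
  - rewrite length_app, IHc; auto.
  - apply length_map.
Qed.

Definition does (A : oracle) (c : cmd) (s s' : nat -> nat) : Prop :=
  forall big k, embedded big k (compile k c) ->
  exists n, steps big A n (s, k) (s', k + clen c).

Lemma does_skip A s : does A CSkip s s.
Proof. intros big k _; exists 0; simpl; rewrite Nat.add_0_r; constructor. Qed.

Lemma does_inc A r s : does A (CInc r) s (upd s r (S (s r))).
Proof.
  intros big k H; exists 1. specialize (H 0 _ eq_refl). rewrite Nat.add_0_r in H.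
  simpl; rewrite Nat.add_1_r. apply (steps_one big A (Inc r)); auto.
Qed.

Lemma does_seq A c d s1 s2 s3 : does A c s1 s2 -> does A d s2 s3 -> does A (CSeq c d) s1 s3.
Proof.
  intros H1 H2 big k H. simpl in H. apply embedded_app in H as [Ha Hb].
  rewrite compile_length in Hb.
  destruct (H1 _ _ Ha) as [n1 S1]. destruct (H2 _ _ Hb) as [n2 S2].
  exists (n1 + n2). simpl. rewrite Nat.add_assoc. eapply steps_trans; eauto.
Qed.

(** Register 1 is 0 after the body, hence the closing [Dec 1 k] jumps back to the test. The count
    [S n] records that a round takes at least one step, as [diverge] demands. *)
Lemma loop_iteration A r c big k s s' m :
  embedded big k (compile k (CLoop r c)) ->
  s r = S m -> does A c (upd s r m) s' -> s' 1 = 0 ->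
  exists n, steps big A (S n) (s, k) (s', k).
Proof.
  intros H Hr Hc H1.
  pose proof (H 0 _ eq_refl) as H0. rewrite Nat.add_0_r in H0.
  simpl in H.
  change (Dec r (k + S (clen c + 1)) :: compile (S k) c ++ [Dec 1 k])
    with ([Dec r (k + S (clen c + 1))] ++ compile (S k) c ++ [Dec 1 k]) in H.
  apply embedded_app in H as [_ H]. apply embedded_app in H as [Ha Hb].
  simpl length in Ha, Hb. rewrite compile_length in Hb.
  replace (k + 1) with (S k) in * by lia.
  destruct (Hc _ _ Ha) as [n S1].
  exists (n + 1). econstructor; [exact H0|].
  simpl. rewrite Hr. eapply steps_trans; [exact S1|].
  specialize (Hb 0 _ eq_refl). rewrite Nat.add_0_r in Hb.
  pose proof (steps_one big A _ s' _ Hb) as S2. simpl in S2. rewrite H1 in S2. exact S2.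
Qed.

Lemma does_loop0 A r c s : s r = 0 -> does A (CLoop r c) s s.
Proof.
  intros Hr big k H. exists 1. specialize (H 0 _ eq_refl). rewrite Nat.add_0_r in H.
  pose proof (steps_one big A _ s _ H) as S2. simpl in S2. rewrite Hr in S2. exact S2.
Qed.

Lemma does_loopS A r c s s' s'' m :
  s r = S m -> does A c (upd s r m) s' -> s' 1 = 0 -> does A (CLoop r c) s' s'' ->
  does A (CLoop r c) s s''.
Proof.
  intros Hr Hc H1 Hl big k H.
  destruct (loop_iteration _ _ _ _ _ _ _ _ H Hr Hc H1) as [n Hn].
  destruct (Hl _ _ H) as [n' Hn'].
  exists (S n + n'). eapply steps_trans; eauto.
Qed.

(** [I m] is the state at the loop head when the counter shows [m]; the body runs from [I (S m)]
    with the counter already lowered to [m]. *)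
Lemma does_loop A r c (I : nat -> nat -> nat) n :
  (forall m, m <= n -> I m r = m) -> (forall m, m < n -> I m 1 = 0) ->
  (forall m, m < n -> does A c (upd (I (S m)) r m) (I m)) ->
  does A (CLoop r c) (I n) (I 0).
Proof.
  intros Hr H1 Hc. induction n as [|n IH].
  - apply does_loop0; apply Hr; lia.
  - eapply does_loopS; [apply Hr; lia| apply Hc; lia | apply H1; lia |].
    apply IH; auto.
Qed.

Lemma does_raw A B P s x v :
  (forall i, s (B + i) = if Nat.eqb i 0 then x else 0) -> halts_with P A x v ->
  exists s', does A (CRaw B P) s s' /\ s' B = v /\
    (forall j, j < B -> s' j = s j) /\ (forall j, B + mreg P <= j -> s' j = s j).
Proof.
  intros Hs [f Hf].
  destruct (raw_steps A P B _ _ _ _ Hf s Hs) as (s' & Hst & Hv & Hlo & Hhi).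
  exists s'. repeat split; auto.
  intros big k Hemb. destruct (Hst big k Hemb) as [n Hn]. exists n.
  rewrite Nat.add_0_r in Hn. exact Hn.
Qed.

(** * Clearing, moving and calling subroutines *)

Fixpoint clear_from (B n : nat) : cmd :=
  match n with O => CSkip | S m => CSeq (CLoop B CSkip) (clear_from (S B) m) end.

Lemma does_clear A r s : s 1 = 0 -> r <> 1 -> does A (CLoop r CSkip) s (upd s r 0).
Proof.
  intros H1 Hr.
  replace s with (upd s r (s r)) at 1 by (apply functional_extensionality; intros; upd_cases).
  apply (does_loop A r CSkip (fun m => upd s r m)); intros.
  - apply upd_eq.
  - rewrite upd_neq; auto.
  - replace (upd (upd s r (S m)) r m) with (upd s r m)
      by (apply functional_extensionality; intros; upd_cases).
    apply does_skip.
Qed.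

Lemma does_clear_from A n : forall B s, s 1 = 0 -> 1 < B ->
  does A (clear_from B n) s (fun j => if (B <=? j) && (j <? B + n) then 0 else s j)%bool.
Proof.
  induction n as [|n IH]; intros B s H1 HB; simpl.
  - match goal with |- does _ _ _ ?g => replace g with s end; [apply does_skip|].
    apply functional_extensionality; intros j; cbn beta.
    destruct (Nat.leb_spec B j), (Nat.ltb_spec j (B + 0)); simpl; auto; lia.
  - eapply does_seq; [apply does_clear; auto; lia|].
    match goal with |- does _ _ _ ?g => replace g with
      (fun j => if (S B <=? j) && (j <? S B + n) then 0 else upd s B 0 j)%bool end.
    + apply IH; [rewrite upd_neq; auto; lia | lia].
    + apply functional_extensionality; intros j; cbn beta.
      destruct (Nat.leb_spec B j), (Nat.leb_spec (S B) j), (Nat.ltb_spec j (S B + n)),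
        (Nat.ltb_spec j (B + S n)); simpl; try lia; upd_cases.
Qed.

Definition move (r q : nat) : cmd := CLoop r (CInc q).

Lemma does_move A r q s : s 1 = 0 -> r <> 1 -> q <> 1 -> r <> q ->
  does A (move r q) s (upd (upd s r 0) q (s q + s r)).
Proof.
  intros H1 Hr Hq Hrq.
  replace s with (upd (upd s r (s r)) q (s q + (s r - s r))) at 1
    by (apply functional_extensionality; intros; upd_cases).
  replace (s q + s r) with (s q + (s r - 0)) by lia.
  apply (does_loop A r (CInc q) (fun m => upd (upd s r m) q (s q + (s r - m)))); intros.
  - rewrite upd_neq, upd_eq; auto.
  - rewrite !upd_neq; auto.
  - set (s' := upd (upd (upd s r (S m)) q _) r m).
    replace (upd (upd s r m) q (s q + (s r - m))) with (upd s' q (S (s' q))).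
    apply does_inc.
    unfold s'; apply functional_extensionality; intros; upd_cases.
Qed.

Definition call (B : nat) (P : program) (r : nat) : cmd :=
  CSeq (move r B) (CSeq (CRaw B P) (CSeq (move B r) (clear_from (S B) (mreg P)))).

Lemma does_call A B P r s v : r < B -> r <> 1 -> 1 < B -> s 1 = 0 ->
  (forall j, B <= j -> s j = 0) -> halts_with P A (s r) v ->
  does A (call B P r) s (upd s r v).
Proof.
  intros Hr Hr1 HB H1 Hz Hv.
  pose proof (mreg_pos P) as Hm.
  destruct (does_raw A B P (upd (upd s r 0) B (s B + s r)) (s r) v) as (s' & Hd & Hv' & Hlo & Hhi); auto.
  { intros [|i]; simpl.
    - rewrite Nat.add_0_r, upd_eq, (Hz B); auto.
    - rewrite !upd_neq by lia. apply Hz; lia. }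
  assert (H1' : s' 1 = 0) by (rewrite Hlo, !upd_neq by lia; auto).
  assert (Hr' : s' r = 0) by (rewrite Hlo, upd_neq, upd_eq by lia; auto).
  eapply does_seq; [apply does_move; auto; lia|].
  eapply does_seq; [exact Hd|].
  eapply does_seq; [apply does_move; auto; lia|].
  match goal with |- does _ _ ?s1 ?s2 =>
    replace s2 with (fun j => if (S B <=? j) && (j <? S B + mreg P) then 0 else s1 j)%bool end.
  - apply does_clear_from; [rewrite !upd_neq; auto; lia|lia].
  - apply functional_extensionality; intros j. rewrite Hr', Hv'. simpl (0 + v).
    destruct (Nat.leb_spec (S B) j), (Nat.ltb_spec j (S B + mreg P)); simpl.
    + rewrite upd_neq, Hz by lia; auto.
    + rewrite !upd_neq, Hhi, !upd_neq by lia; auto.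
    + destruct (Nat.eq_dec j r) as [->|]; [rewrite !upd_eq; auto|].
      rewrite (upd_neq _ r), (upd_neq s r) by auto.
      destruct (Nat.eq_dec j B) as [->|]; [rewrite upd_eq, Hz; auto|].
      rewrite upd_neq, Hlo, !upd_neq; auto; lia.
    + lia.
Qed.

Lemma halts_with_compile A c x s :
  does A c (fun k => if Nat.eqb k 0 then x else 0) s -> halts_with (compile 0 c) A x (s 0).
Proof.
  intros H. destruct (H (compile 0 c) 0) as [n Hn]; [intros i ins Hi; exact Hi|].
  exists (n + 0). unfold run.
  pose proof (run_aux_steps _ _ _ _ _ 0 Hn) as E. simpl fst in E; simpl snd in E.
  rewrite E. simpl.
  assert (Hnone : nth_error (compile 0 c) (clen c) = None)
    by (apply nth_error_None; rewrite compile_length; auto).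
  rewrite Hnone; auto.
Qed.

(** Under the invariant [I] the counter is never 0, so the loop head is visited forever and
    [diverge] applies there. *)
Lemma loop_diverges A c r d x (I : (nat -> nat) -> Prop) s :
  does A c (fun k => if Nat.eqb k 0 then x else 0) s -> I s ->
  (forall s, I s -> exists m s', s r = S m /\ does A d (upd s r m) s' /\ s' 1 = 0 /\ I s') ->
  ~ halts (compile 0 (CSeq c (CLoop r d))) A x.
Proof.
  intros Hc Is Hloop (f & v & Hf).
  set (big := compile 0 (CSeq c (CLoop r d))) in *.
  assert (E : embedded big 0 (compile 0 (CSeq c (CLoop r d)))) by (intros i ins Hi; exact Hi).
  simpl compile in E. apply embedded_app in E as [E1 E2].
  rewrite compile_length in E2. simpl in E2.
  destruct (Hc _ _ E1) as [n Hn].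
  destruct (run_aux_steps_inv _ _ _ _ _ _ _ Hn Hf) as [_ Hf'].
  rewrite (diverge big A (fun cf => I (fst cf) /\ snd cf = clen c)) in Hf'; [discriminate| |auto].
  intros [s1 pc] [HI Hpc]. simpl in HI, Hpc. subst pc.
  destruct (Hloop _ HI) as (m & s2 & Hm & Hd & H1 & HI').
  destruct (loop_iteration _ _ _ _ _ _ _ _ E2 Hm Hd H1) as [n' Hn'].
  exists (S n'), (s2, clen c). repeat split; auto. lia.
Qed.

(** * Closure properties of the functions computable in an oracle *)

(** Register contents that vanish beyond a finite list; on concrete lists the effect of each command
    is found by computation. *)
Definition ls (l : list nat) : nat -> nat := fun k => nth k l 0.

Fixpoint lup (l : list nat) (r v : nat) : list nat :=
  match l, r with
  | [], _ => []
  | _ :: t, O => v :: t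
  | a :: t, S q => a :: lup t q v
  end.

Lemma upd_ls l : forall r v, r < length l -> upd (ls l) r v = ls (lup l r v).
Proof.
  intros r v Hr; apply functional_extensionality; intros k. unfold upd, ls.
  revert r Hr k; induction l as [|a l IH]; intros r Hr k; simpl in Hr; [lia|].
  destruct r as [|r], k as [|k]; simpl; auto.
  apply IH; lia.
Qed.

Lemma init_ls x n : (fun k => if Nat.eqb k 0 then x else 0) = ls (x :: repeat 0 n).
Proof.
  apply functional_extensionality; intros [|k]; unfold ls; simpl; auto.
  revert k; induction n; intros [|k]; simpl; auto.
Qed.

Lemma ls_inc A l r : r < length l -> does A (CInc r) (ls l) (ls (lup l r (S (nth r l 0)))).
Proof. intros Hr. rewrite <- upd_ls by auto. exact (does_inc A r (ls l)). Qed.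

Lemma ls_call A l P r v : r < length l -> r <> 1 -> 1 < length l -> nth 1 l 0 = 0 ->
  halts_with P A (nth r l 0) v -> does A (call (length l) P r) (ls l) (ls (lup l r v)).
Proof.
  intros. rewrite <- upd_ls by auto. apply does_call; auto.
  intros j Hj. apply nth_overflow; auto.
Qed.

Lemma ls_move A l r q : r < length l -> q < length l -> nth 1 l 0 = 0 ->
  r <> 1 -> q <> 1 -> r <> q ->
  does A (move r q) (ls l) (ls (lup (lup l r 0) q (nth q l 0 + nth r l 0))).
Proof.
  assert (Hlen : forall l r v, length (lup l r v) = length l)
    by (intros l0; induction l0; intros [|k] v; simpl; auto).
  intros. rewrite <- !upd_ls by (rewrite ?Hlen; auto).
  apply (does_move A r q (ls l)); auto.
Qed.

Lemma ls_clear A l r : r < length l -> nth 1 l 0 = 0 -> r <> 1 ->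
  does A (CLoop r CSkip) (ls l) (ls (lup l r 0)).
Proof. intros. rewrite <- upd_ls by auto. apply does_clear; auto. Qed.

Lemma ls_loop A r c (I : nat -> list nat) n l l' :
  l = I n -> l' = I 0 ->
  (forall m, r < length (I m) /\ nth r (I m) 0 = m /\ nth 1 (I m) 0 = 0) ->
  (forall m, m < n -> does A c (ls (lup (I (S m)) r m)) (ls (I m))) ->
  does A (CLoop r c) (ls l) (ls l').
Proof.
  intros -> -> HI Hc. apply (does_loop A r c (fun m => ls (I m))).
  - intros; apply HI.
  - intros; apply HI.
  - intros; rewrite upd_ls by apply HI; auto.
Qed.

Lemma ls_loop_once A r c l l' m : r < length l -> nth r l 0 = S m ->
  does A c (ls (lup l r m)) (ls l') -> nth r l' 0 = 0 -> nth 1 l' 0 = 0 ->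
  does A (CLoop r c) (ls l) (ls l').
Proof.
  intros Hr Hm Hc H0 H1. apply (does_loopS A r c (ls l) (ls l') (ls l') m); auto.
  - rewrite upd_ls; auto.
  - apply does_loop0; auto.
Qed.

Lemma ls_loop_zero A r c l : nth r l 0 = 0 -> does A (CLoop r c) (ls l) (ls l).
Proof. intros H; apply does_loop0; exact H. Qed.

Definition Comp (A : oracle) (f : nat -> nat) : Prop :=
  exists P, forall x, halts_with P A x (f x).

Lemma Comp_of_cmd A (f : nat -> nat) n c :
  (forall x, exists l, does A c (ls (x :: repeat 0 n)) (ls (f x :: l))) -> Comp A f.
Proof.
  intros H. exists (compile 0 c). intros x. destruct (H x) as [l Hl].
  rewrite <- init_ls in Hl. apply halts_with_compile in Hl. exact Hl.
Qed.

Lemma Comp_ext A f g : Comp A f -> (forall x, f x = g x) -> Comp A g.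
Proof. intros [P HP] H. exists P. intros x; rewrite <- H; auto. Qed.

Lemma Comp_id A : Comp A (fun x => x).
Proof. exists []. intros x; exists 0; reflexivity. Qed.

Lemma Comp_oracle0 A : Comp A (fun x => if A x then 1 else 0).
Proof. exists [Orc 0]. intros x; exists 1; reflexivity. Qed.

Lemma Comp_pred0 A : Comp A pred.
Proof. exists [Dec 0 1]. intros x; exists 1; destruct x; reflexivity. Qed.

Lemma Comp_zero A : Comp A (fun _ => 0).
Proof.
  apply (Comp_of_cmd A _ 1 (CLoop 0 CSkip)). intros x. eexists.
  apply (ls_clear A [x; 0] 0); simpl; auto.
Qed.

Lemma Comp_S0 A : Comp A S.
Proof.
  apply (Comp_of_cmd A _ 1 (CInc 0)). intros x. eexists. apply (ls_inc A [x; 0] 0); simpl; auto.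
Qed.

(** [P] has to halt only at the arguments [f x]. This matters for programs specified only on codes,
    such as a decider for the halting problem. *)
Lemma Comp_comp_rel A P f v : Comp A f -> (forall x, halts_with P A (f x) (v x)) -> Comp A v.
Proof.
  intros [Q HQ] HP. apply (Comp_of_cmd A _ 1 (CSeq (call 2 Q 0) (call 2 P 0))).
  intros x. eexists. eapply does_seq.
  - apply (ls_call A [x; 0] Q 0 (f x)); simpl; auto.
  - apply (ls_call A [f x; 0] P 0 (v x)); simpl; auto.
Qed.

Lemma Comp_comp A f g : Comp A f -> Comp A g -> Comp A (fun x => g (f x)).
Proof. intros Hf [P HP]. eapply Comp_comp_rel; eauto. Qed.

Lemma Comp_S A f : Comp A f -> Comp A (fun x => S (f x)).
Proof. intros; apply (Comp_comp A f S); auto using Comp_S0. Qed.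

Lemma Comp_pred A f : Comp A f -> Comp A (fun x => pred (f x)).
Proof. intros; apply (Comp_comp A f pred); auto using Comp_pred0. Qed.

Lemma Comp_oracle A f : Comp A f -> Comp A (fun x => if A (f x) then 1 else 0).
Proof. intros. apply (Comp_comp A f (fun x => if A x then 1 else 0)); auto using Comp_oracle0. Qed.

Lemma Comp_const A n : Comp A (fun _ => n).
Proof. induction n; auto using Comp_zero, Comp_S. Qed.

Definition copy0 (q r : nat) : cmd := CLoop 0 (CSeq (CInc q) (CInc r)).

Lemma ls_copy0 A x a b l :
  does A (copy0 2 3) (ls (x :: 0 :: a :: b :: l)) (ls (0 :: 0 :: (a + x) :: (b + x) :: l)).
Proof.
  apply (ls_loop A _ _ (fun m => m :: 0 :: (a + (x - m)) :: (b + (x - m)) :: l) x).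
  1, 2: repeat f_equal; lia.
  - intros m; simpl; repeat split; lia.
  - intros m Hm. simpl lup.
    replace (a + (x - m)) with (S (a + (x - S m))) by lia.
    replace (b + (x - m)) with (S (b + (x - S m))) by lia.
    eapply does_seq; [apply ls_inc; simpl; lia|]. apply ls_inc; simpl; lia.
Qed.

(** The number of rounds and the start value are computed first; then [f] acts on register 0 while
    register 2 counts down. The arithmetic below and the recursion for y are all obtained as such
    iterations. *)
Lemma Comp_iter A n f g : Comp A n -> Comp A f -> Comp A g ->
  Comp A (fun x => Nat.iter (n x) f (g x)).
Proof.
  intros [Pn Hn] [Pf Hf] [Pg Hg].
  apply (Comp_of_cmd A _ 3
    (CSeq (copy0 2 3) (CSeq (call 4 Pn 2) (CSeq (call 4 Pg 3)
      (CSeq (move 3 0) (CLoop 2 (call 4 Pf 0))))))).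
  intros x. eexists. simpl repeat.
  eapply does_seq; [apply ls_copy0|]. simpl.
  eapply does_seq; [apply (ls_call A [0; 0; x; x] Pn 2 (n x)); simpl; auto|]. simpl.
  eapply does_seq; [apply (ls_call A [0; 0; n x; x] Pg 3 (g x)); simpl; auto|]. simpl.
  eapply does_seq; [apply ls_move; simpl; lia|]. simpl.
  apply (ls_loop A _ _ (fun m => [Nat.iter (n x - m) f (g x); 0; m; 0]) (n x)).
  - rewrite Nat.sub_diag; reflexivity.
  - rewrite Nat.sub_0_r; reflexivity.
  - intros m; simpl; lia.
  - intros m Hm. replace (n x - m) with (S (n x - S m)) by lia.
    apply (ls_call A [_; 0; m; 0] Pf 0); simpl; auto.
Qed.

(** * Cantor pairing and its inverse *)

Fixpoint tri (n : nat) : nat := match n with O => 0 | S m => S m + tri m end.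

Lemma cpair_tri x y : cpair x y = tri (x + y) + y.
Proof.
  unfold cpair. f_equal.
  assert (H : forall n, n * (n + 1) = tri n * 2) by (induction n; simpl; lia).
  rewrite H. apply Nat.div_mul; auto.
Qed.

Lemma Comp_pair A f g : Comp A f -> Comp A g -> Comp A (fun x => cpair (f x) (g x)).
Proof.
  intros [Pf Hf] [Pg Hg].
  apply (Comp_of_cmd A _ 4
    (CSeq (copy0 2 3) (CSeq (call 5 Pf 2) (CSeq (call 5 Pg 3)
      (CSeq (CLoop 3 (CSeq (CInc 0) (CInc 2)))
        (CLoop 2 (CSeq (CInc 0) (CSeq (CLoop 2 (CSeq (CInc 0) (CInc 4))) (move 4 2))))))))).
  intros x. eexists. simpl repeat.
  eapply does_seq; [apply ls_copy0|]. simpl.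
  eapply does_seq; [apply (ls_call A [0; 0; x; x; 0] Pf 2 (f x)); simpl; auto|]. simpl.
  eapply does_seq; [apply (ls_call A [0; 0; f x; x; 0] Pg 3 (g x)); simpl; auto|]. simpl.
  generalize (f x) (g x); intros a b. rewrite cpair_tri.
  eapply does_seq.
  { apply (ls_loop A _ _ (fun m => [b - m; 0; a + (b - m); m; 0]) b).
    1: repeat f_equal; lia.
    1: reflexivity.
    - intros m; simpl; lia.
    - intros m Hm. simpl lup.
      replace (a + (b - m)) with (S (a + (b - S m))) by lia.
      replace (b - m) with (S (b - S m)) by lia.
      eapply does_seq; [apply ls_inc; simpl; lia|]. apply ls_inc; simpl; lia. }
  simpl. rewrite Nat.sub_0_r.
  pose (inv := fun m => [tri (a + b) - tri m + b; 0; m; 0; 0]).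
  apply (ls_loop A _ _ inv (a + b)).
  1, 2: unfold inv; simpl; repeat f_equal; lia.
  - intros m; simpl; lia.
  - intros m Hm. unfold inv at 1. simpl lup.
    assert (Htri : tri (S m) <= tri (a + b)).
    { assert (Hmono : forall i j, i <= j -> tri i <= tri j)
        by (induction 1; simpl; lia).
      apply Hmono; lia. }
    simpl in Htri.
    eapply does_seq; [apply ls_inc; simpl; lia|]. simpl lup. simpl nth.
    pose (w := S (tri (a + b) - tri (S m) + b)). fold w.
    eapply does_seq.
    { apply (ls_loop A _ _ (fun k => [w + (m - k); 0; k; 0; m - k]) m).
      1: rewrite Nat.sub_diag, Nat.add_0_r; reflexivity.
      1: reflexivity.
      - intros k; simpl; lia.
      - intros k Hk. simpl lup.
        replace (w + (m - k)) with (S (w + (m - S k))) by lia.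
        replace (m - k) with (S (m - S k)) by lia.
        eapply does_seq; [apply ls_inc; simpl; lia|]. apply ls_inc; simpl; lia. }
    simpl. rewrite Nat.sub_0_r.
    replace (inv m) with (lup (lup [w + m; 0; 0; 0; m] 4 0) 2 (0 + m))
      by (unfold inv, w; simpl; repeat (f_equal; try lia)).
    apply (ls_move A [w + m; 0; 0; 0; m]); simpl; lia.
Qed.

(* Successor of a pair in the order of its Cantor code. *)
Definition next_pair (c : nat * nat) : nat * nat :=
  match c with (O, y) => (S y, O) | (S x, y) => (x, S y) end.

Definition unpair (n : nat) : nat * nat := Nat.iter n next_pair (0, 0).
Definition pfst (n : nat) : nat := fst (unpair n).
Definition psnd (n : nat) : nat := snd (unpair n).

(** Outer induction on the diagonal [x + y], inner induction on [y] along it; the first point of a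
    diagonal is the successor of the last point [(0, s)] of the previous one. *)
Lemma unpair_cpair x y : unpair (cpair x y) = (x, y).
Proof.
  rewrite cpair_tri. remember (x + y) as s eqn:Es. revert x y Es.
  induction s as [|s IH]; intros x y; revert x; induction y as [|y IHy]; intros x Es.
  - assert (x = 0) as -> by lia. reflexivity.
  - lia.
  - assert (x = S s) as -> by lia.
    replace (tri (S s) + 0) with (S (tri s + s)) by (simpl; lia).
    simpl. fold (unpair (tri s + s)). rewrite (IH 0 s) by lia. reflexivity.
  - rewrite Nat.add_succ_r. simpl Nat.iter. fold (unpair (tri (S s) + y)).
    change (next_pair (unpair (tri (S s) + y)) = (x, S y)).
    rewrite (IHy (S x)) by lia. reflexivity.
Qed.

Lemma pfst_cpair x y : pfst (cpair x y) = x.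
Proof. unfold pfst; rewrite unpair_cpair; auto. Qed.
Lemma psnd_cpair x y : psnd (cpair x y) = y.
Proof. unfold psnd; rewrite unpair_cpair; auto. Qed.

(* Registers 2 and 3 hold the pair, register 4 flags a zero first component. *)
Definition next_pair_cmd : cmd :=
  CSeq (CInc 4) (CSeq (CLoop 2 (CSeq (CLoop 4 CSkip) (CSeq (CInc 3) (move 2 5))))
    (CSeq (move 5 2) (CLoop 4 (CSeq (move 3 2) (CInc 2))))).

Lemma ls_next_pair A z c :
  does A next_pair_cmd (ls [z; 0; fst c; snd c; 0; 0])
    (ls [z; 0; fst (next_pair c); snd (next_pair c); 0; 0]).
Proof.
  destruct c as [[|x] y]; simpl.
  - eapply does_seq; [apply ls_inc; simpl; lia|]. simpl.
    eapply does_seq; [apply ls_loop_zero; auto|].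
    eapply does_seq; [apply ls_move; simpl; lia|]. simpl.
    eapply ls_loop_once; [simpl; lia|reflexivity| |reflexivity|reflexivity]. simpl.
    eapply does_seq; [apply ls_move; simpl; lia|]. simpl.
    apply ls_inc; simpl; lia.
  - eapply does_seq; [apply ls_inc; simpl; lia|]. simpl.
    eapply does_seq.
    { eapply (ls_loop_once _ _ _ _ [z; 0; 0; S y; 0; x]);
        [simpl; lia|reflexivity| |reflexivity|reflexivity]. simpl.
      eapply does_seq; [apply ls_clear; simpl; lia|]. simpl.
      eapply does_seq; [apply ls_inc; simpl; lia|]. simpl.
      apply (ls_move A [z; 0; x; S y; 0; 0]); simpl; lia. }
    eapply does_seq; [apply ls_move; simpl; lia|]. simpl.
    apply ls_loop_zero; auto.
Qed.

Lemma ls_unpair A z : does A (CLoop 0 next_pair_cmd) (ls [z; 0; 0; 0; 0; 0])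
  (ls [0; 0; pfst z; psnd z; 0; 0]).
Proof.
  pose (inv := fun m => [m; 0; pfst (z - m); psnd (z - m); 0; 0]).
  apply (ls_loop A _ _ inv z); unfold inv.
  - rewrite Nat.sub_diag; auto.
  - rewrite Nat.sub_0_r; auto.
  - intros m; simpl; lia.
  - intros m Hm. unfold pfst, psnd. replace (z - m) with (S (z - S m)) by lia.
    apply ls_next_pair.
Qed.

Lemma Comp_pfst0 A : Comp A pfst.
Proof.
  apply (Comp_of_cmd A _ 5 (CSeq (CLoop 0 next_pair_cmd) (move 2 0))). intros x. eexists.
  eapply does_seq; [apply ls_unpair|]. 
  apply (ls_move A [0; 0; pfst x; psnd x; 0; 0] 2 0); simpl; lia.
Qed.

Lemma Comp_psnd0 A : Comp A psnd.
Proof.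
  apply (Comp_of_cmd A _ 5 (CSeq (CLoop 0 next_pair_cmd) (move 3 0))). intros x. eexists.
  eapply does_seq; [apply ls_unpair|]. 
  apply (ls_move A [0; 0; pfst x; psnd x; 0; 0] 3 0); simpl; lia.
Qed.

Lemma Comp_pfst A f : Comp A f -> Comp A (fun x => pfst (f x)).
Proof. intros; apply (Comp_comp A f pfst); auto using Comp_pfst0. Qed.
Lemma Comp_psnd A f : Comp A f -> Comp A (fun x => psnd (f x)).
Proof. intros; apply (Comp_comp A f psnd); auto using Comp_psnd0. Qed.

(** * Arithmetic *)

Lemma Comp_add A f g : Comp A f -> Comp A g -> Comp A (fun x => f x + g x).
Proof.
  intros Hf Hg. eapply Comp_ext; [apply (Comp_iter A f S g); auto using Comp_S0|].
  intros x; simpl. induction (f x); simpl; auto.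
Qed.

Lemma Comp_sub A f g : Comp A f -> Comp A g -> Comp A (fun x => f x - g x).
Proof.
  intros Hf Hg. eapply Comp_ext; [apply (Comp_iter A g pred f); auto using Comp_pred0|].
  intros x; simpl. induction (g x); simpl; lia.
Qed.

Lemma Comp_mul A f g : Comp A f -> Comp A g -> Comp A (fun x => f x * g x).
Proof.
  intros Hf Hg.
  (* The iterated pair keeps the fixed factor next to the running product. *)
  pose (st := fun z => cpair (pfst z) (pfst z + psnd z)).
  assert (Hst : Comp A st)
    by (apply Comp_pair; [|apply Comp_add]; auto using Comp_pfst0, Comp_psnd0).
  eapply Comp_ext.
  { apply Comp_psnd. apply (Comp_iter A f st (fun x => cpair (g x) 0)); auto.
    apply Comp_pair; auto using Comp_const. }
  intros x; simpl.
  assert (E : Nat.iter (f x) st (cpair (g x) 0) = cpair (g x) (f x * g x)).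
  { induction (f x); simpl; auto. rewrite IHn. unfold st.
    rewrite pfst_cpair, psnd_cpair; auto. }
  rewrite E, psnd_cpair; auto.
Qed.

(** * Unbounded search *)

Definition search_body (Pf Pg : program) : cmd :=
  CSeq (CLoop 2 CSkip) (CSeq (call 4 Pf 0) (CSeq (copy0 2 3) (CSeq (move 3 0) (call 4 Pg 2)))).

Lemma ls_search_body A Pf Pg f g z m :
  (forall x, halts_with Pf A x (f x)) -> (forall x, halts_with Pg A x (g x)) ->
  does A (search_body Pf Pg) (ls [z; 0; m; 0]) (ls [f z; 0; g (f z); 0]).
Proof.
  intros Hf Hg.
  eapply does_seq; [apply ls_clear; simpl; lia|]. simpl.
  eapply does_seq; [apply (ls_call A [z; 0; 0; 0] Pf 0 (f z)); simpl; auto|]. simpl.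
  eapply does_seq; [apply ls_copy0|]. simpl.
  eapply does_seq; [apply ls_move; simpl; lia|]. simpl.
  apply (ls_call A [f z; 0; f z; 0] Pg 2); simpl; auto.
Qed.

(** The loop replaces register 0 by its image under [f] and puts the value of [g] there into
    register 2, which serves as the loop counter; so it stops exactly at a zero of [g]. *)
Lemma search_program A f g h : Comp A f -> Comp A g -> Comp A h ->
  exists Q, forall x, halts Q A x <-> exists n, g (Nat.iter (S n) f (h x)) = 0.
Proof.
  intros [Pf Hf] [Pg Hg] [Ph Hh].
  exists (compile 0 (CSeq (CSeq (call 4 Ph 0) (CInc 2)) (CLoop 2 (search_body Pf Pg)))).
  intros x.
  (* Register 2 starts at 1, which lets the loop begin before [g] has been evaluated. *)
  assert (Hinit : does A (CSeq (call 4 Ph 0) (CInc 2)) (fun k => if Nat.eqb k 0 then x else 0)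
                    (ls [h x; 0; 1; 0])).
  { rewrite (init_ls x 3). simpl.
    eapply does_seq; [apply (ls_call A [x; 0; 0; 0] Ph 0 (h x)); simpl; auto|]. simpl.
    apply (ls_inc A [h x; 0; 0; 0]); simpl; lia. }
  split.
  - intros Hhalt.
    destruct (Classical_Prop.classic (exists n, g (Nat.iter (S n) f (h x)) = 0)) as [|Hno]; auto.
    exfalso. revert Hhalt.
    (* If [g] never vanishes along the orbit, register 2 is nonzero at every visit to the loop
       head. *)
    apply (loop_diverges _ _ _ _ _
      (fun s => exists n m, s = ls [Nat.iter n f (h x); 0; S m; 0]) _ Hinit).
    + exists 0, 0; reflexivity.
    + intros s (n & m & ->).
      exists m, (ls [f (Nat.iter n f (h x)); 0; g (f (Nat.iter n f (h x))); 0]).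
      repeat split.
      * rewrite upd_ls by (simpl; lia). simpl. apply ls_search_body; auto.
      * exists (S n). destruct (g (f (Nat.iter n f (h x)))) as [|m'] eqn:E.
        -- exfalso; apply Hno; exists n; exact E.
        -- exists m'; reflexivity.
  - intros [n Hn].
    assert (Hloop : forall n z m, g (Nat.iter (S n) f z) = 0 ->
      exists s, does A (CLoop 2 (search_body Pf Pg)) (ls [z; 0; S m; 0]) s).
    { clear -Hf Hg. intros n; induction n as [|n IH]; intros z m H.
      - simpl in H. eexists. eapply (does_loopS _ _ _ _ (ls [f z; 0; g (f z); 0]) _ m); auto.
        + rewrite upd_ls by (simpl; lia). simpl. apply ls_search_body; auto.
        + apply does_loop0; exact H.
      - destruct (g (f z)) as [|m'] eqn:E.
        + eexists. eapply (does_loopS _ _ _ _ (ls [f z; 0; g (f z); 0]) _ m); auto.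
          * rewrite upd_ls by (simpl; lia). simpl. apply ls_search_body; auto.
          * apply does_loop0; exact E.
        + rewrite Nat.iter_succ_r in H. destruct (IH (f z) m' H) as [s Hs].
          exists s. eapply (does_loopS _ _ _ _ (ls [f z; 0; g (f z); 0]) _ m); auto.
          * rewrite upd_ls by (simpl; lia). simpl. apply ls_search_body; auto.
          * rewrite E; exact Hs. }
    destruct (Hloop n (h x) 0 Hn) as [s Hs].
    destruct (halts_with_compile A _ x s (does_seq _ _ _ _ _ _ Hinit Hs)) as [k Hk].
    exists k, (s 0); exact Hk.
Qed.

(* The shift by [pred] compensates for [search_program] testing only after its first step. *)
Lemma Comp_search A g : Comp A g ->
  exists Q, forall x, halts Q A x <-> exists t, g (cpair x t) = 0.
Proof.
  intros Hg.
  destruct (search_program A (fun z => cpair (pfst z) (S (psnd z)))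
    (fun z => g (cpair (pfst z) (pred (psnd z)))) (fun x => cpair x 0)) as [Q HQ].
  - apply Comp_pair; [|apply Comp_S]; auto using Comp_pfst0, Comp_psnd0.
  - apply (Comp_comp A (fun z => cpair (pfst z) (pred (psnd z))) g); auto.
    apply Comp_pair; [|apply Comp_pred]; auto using Comp_pfst0, Comp_psnd0.
  - apply Comp_pair; auto using Comp_id, Comp_const.
  - exists Q. intros x. rewrite HQ.
    assert (E : forall n, Nat.iter n (fun z => cpair (pfst z) (S (psnd z))) (cpair x 0) = cpair x n).
    { induction n; simpl; auto. rewrite IHn, pfst_cpair, psnd_cpair; auto. }
    split; intros [n Hn]; exists n; revert Hn; rewrite E, pfst_cpair, psnd_cpair; auto.
Qed.

(** * The sequence y *)

Lemma Comp_half A f : Comp A f -> Comp A (fun x => f x / 2).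
Proof.
  intros Hf.
  (* The [n]-th iterate is the pair of [n / 2] and [S n / 2]: a step moves the second entry forward
     and adds one to the first. *)
  pose (st := fun z => cpair (psnd z) (S (pfst z))).
  assert (Hst : Comp A st)
    by (apply Comp_pair; [|apply Comp_S]; auto using Comp_pfst0, Comp_psnd0).
  eapply Comp_ext.
  { apply Comp_pfst. apply (Comp_iter A f st (fun _ => cpair 0 0)); auto using Comp_const. }
  intros x; simpl.
  assert (E : forall n, Nat.iter n st (cpair 0 0) = cpair (n / 2) (S n / 2)).
  { induction n as [|n IH]; simpl Nat.iter; [reflexivity|].
    rewrite IH. unfold st. rewrite pfst_cpair, psnd_cpair. f_equal.
    replace (S (S n)) with (n + 1 * 2) by lia. rewrite Nat.div_add by lia. lia. }
  rewrite E, pfst_cpair; auto.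
Qed.

(* [apply] eta-contracts its subgoals, hence the eta-expansion at each round. *)
Ltac comp := repeat (
  match goal with |- Comp ?A ?f => change (Comp A (fun x => f x)); cbn beta end;
  lazymatch goal with
  | |- Comp _ (fun _ => ?n) => apply Comp_const
  | |- Comp _ (fun x => x) => apply Comp_id
  | |- Comp _ (fun x => cpair (@?f x) (@?g x)) => apply Comp_pair
  | |- Comp _ (fun x => (@?f x) * (@?g x)) => apply Comp_mul
  | |- Comp _ (fun x => (@?f x) - (@?g x)) => apply Comp_sub
  | |- Comp _ (fun x => (@?f x) + (@?g x)) => apply Comp_add
  | |- Comp _ (fun x => S (@?f x)) => apply Comp_S
  | |- Comp _ (fun x => pfst (@?f x)) => apply Comp_pfst
  | |- Comp _ (fun x => psnd (@?f x)) => apply Comp_psnd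
  | |- Comp _ (fun x => (@?f x) / 2) => apply Comp_half
  end).

(** * Coding of strings *)

Fixpoint bsucc (s : bstring) : bstring :=
  match s with [] => [false] | false :: t => true :: t | true :: t => false :: bsucc t end.

(** [scode] reads a string as a bijective base-two numeral, least significant digit first, with
    digits 1 and 2 for [false] and [true]. Since [bsucc] is the successor on these numerals, its
    iterates from the empty string invert [scode]. *)
Definition sdec (n : nat) : bstring := Nat.iter n bsucc [].

Lemma scode_sdec n : scode (sdec n) = n.
Proof.
  assert (H : forall s, scode (bsucc s) = S (scode s)).
  { induction s as [|[|] s IH]; cbn [bsucc scode]; lia. }
  induction n as [|n IH]; simpl; auto. rewrite H, IH; auto.
Qed.

Lemma scode_inj s : forall t, scode s = scode t -> s = t.
Proof.
  induction s as [|a s IH]; intros [|c t] H; cbn [scode] in H; auto.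
  - destruct c; lia.
  - destruct a; lia.
  - assert (a = c) as -> by (destruct a, c; auto; lia).
    f_equal. apply IH. lia.
Qed.

Lemma sdec_scode s : sdec (scode s) = s.
Proof. apply scode_inj, scode_sdec. Qed.

Lemma scode_snoc s c :
  scode (s ++ [c]) = scode s + 2 ^ length s * (1 + if c then 1 else 0).
Proof.
  induction s as [|a s IH]; cbn [app scode length Nat.pow]; [destruct c; simpl; lia|].
  rewrite IH. destruct a; ring.
Qed.

(** Equality holds for strings consisting of [true] only. The bound lets [code_weight] of a string
    be compared with that of its children. *)
Lemma scode_bound s : scode s + 2 <= 2 * 2 ^ length s.
Proof. induction s as [|[|] s IH]; cbn [scode length Nat.pow]; lia. Qed.

Lemma prefix_S y n : prefix y (S n) = prefix y n ++ [y n].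
Proof. unfold prefix. rewrite seq_S, map_app. reflexivity. Qed.

Lemma prefix_length y n : length (prefix y n) = n.
Proof. unfold prefix. rewrite length_map, length_seq; auto. Qed.

(** * The recursion that produces y *)

Section Construction.
Context (b : oracle) (q : nat -> nat).

(* A state codes <n, 2^n, K, code of y|n, N, E>, where p_n = K / 2^n and r (y|n) = N / E. *)
Definition stn z := pfst z.
Definition stW z := pfst (psnd z).
Definition stK z := pfst (psnd (psnd z)).
Definition stc z := pfst (psnd (psnd (psnd z))).
Definition stN z := pfst (psnd (psnd (psnd (psnd z)))).
Definition stE z := psnd (psnd (psnd (psnd (psnd z)))).

Definition mkst n W K c N E := cpair n (cpair W (cpair K (cpair c (cpair N E)))).

(** The question at stage n: does M at the [false] child of y|n exceed r (y|n) * p_n? Adding [stW]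
    to the code appends [false], and the fraction N K / (E 2^n) is the threshold. *)
Definition qarg z := cpair (stc z + stW z) (cpair (stN z * stK z) (stE z * stW z)).

(** The answer, 0 or 1, enters as a number and selects the factor K or W - K, so that the step is a
    composition of functions already known to be computable. Bit n of the oracle joins K only for
    the next stage. *)
Definition next z :=
  mkst (S (stn z)) (2 * stW z) (2 * stK z + (if b (stn z) then 1 else 0))
    (stc z + stW z * (1 + q (qarg z)))
    (q (qarg z) * (stN z * (stW z - stK z)) + (1 - q (qarg z)) * (stN z * stK z))
    (stE z * stW z).

Definition state n := Nat.iter n next (mkst 0 1 0 0 1 1).

Definition ybit n := Nat.eqb (q (qarg (state n))) 1.

Lemma Comp_state_code : Comp b q -> Comp b (fun n => stc (state n)).
Proof.
  intros Hq.
  assert (Harg : Comp b qarg) by (unfold qarg, stc, stW, stN, stK, stE; comp).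
  assert (Hqa : Comp b (fun z => q (qarg z))) by (apply (Comp_comp b qarg q); auto).
  assert (Hb : Comp b (fun z => if b (stn z) then 1 else 0))
    by (apply Comp_oracle; unfold stn; comp).
  assert (Hnext : Comp b next)
    by (unfold next, mkst, stc, stW, stN, stK, stE, stn; comp; first [exact Hqa | exact Hb]).
  unfold stc; comp. unfold state. apply (Comp_iter b (fun n => n) next); comp. exact Hnext.
Qed.

Ltac st_simpl := unfold stn, stW, stK, stc, stN, stE, mkst;
  repeat (rewrite pfst_cpair || rewrite psnd_cpair).

Lemma state_S n : state (S n) = next (state n).
Proof. reflexivity. Qed.

Lemma stn_state n : stn (state n) = n.
Proof.
  induction n; [unfold state; simpl; st_simpl; auto|].
  rewrite state_S. unfold next. st_simpl. f_equal; exact IHn.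
Qed.

Lemma stW_state n : stW (state n) = 2 ^ n.
Proof.
  induction n; [unfold state; simpl; st_simpl; auto|].
  rewrite state_S. cbn [Nat.pow]. rewrite <- IHn. unfold next. st_simpl. lia.
Qed.

Lemma stK_state n :
  stK (state (S n)) = 2 * stK (state n) + (if b n then 1 else 0).
Proof.
  rewrite state_S. unfold next. rewrite stn_state. st_simpl. reflexivity.
Qed.

Lemma stK_0 : stK (state 0) = 0.
Proof. unfold state; simpl; st_simpl; auto. Qed.

(** As p_n < 1, the truncated subtraction W - K in [next] is a true one. *)
Lemma stK_le n : stK (state n) < 2 ^ n.
Proof.
  induction n; [rewrite stK_0; simpl; lia|].
  rewrite stK_state. cbn [Nat.pow]. destruct (b n); lia.
Qed.

Lemma stE_state n : stE (state (S n)) = stE (state n) * 2 ^ n.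
Proof. rewrite <- stW_state, state_S. unfold next. st_simpl. reflexivity. Qed.

Lemma stE_0 : stE (state 0) = 1.
Proof. unfold state; simpl; st_simpl; auto. Qed.

Lemma stE_pos n : 0 < stE (state n).
Proof.
  induction n; [rewrite stE_0; lia|]. rewrite stE_state.
  apply Nat.mul_pos_pos; auto. pose proof (Nat.pow_nonzero 2 n); lia.
Qed.

Context (Hq01 : forall x, q x = 0 \/ q x = 1).

Lemma stc_state n : stc (state n) = scode (prefix ybit n).
Proof.
  induction n; [unfold state; simpl; st_simpl; auto|].
  rewrite prefix_S, scode_snoc, prefix_length, <- IHn, <- stW_state, state_S.
  unfold ybit. destruct (Hq01 (qarg (state n))) as [E|E];
  rewrite E; unfold next; rewrite E; simpl Nat.eqb; st_simpl; reflexivity.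
Qed.

Lemma stN_0 : stN (state 0) = 1.
Proof. unfold state; simpl; st_simpl; auto. Qed.

Lemma stN_state n : stN (state (S n)) =
  stN (state n) * (if ybit n then 2 ^ n - stK (state n) else stK (state n)).
Proof.
  rewrite <- stW_state, state_S.
  unfold ybit. destruct (Hq01 (qarg (state n))) as [E|E];
  rewrite E; unfold next; rewrite E; simpl Nat.eqb; st_simpl; cbn iota; lia.
Qed.

Lemma qarg_state n : qarg (state n) =
  cpair (scode (prefix ybit n ++ [false]))
    (cpair (stN (state n) * stK (state n)) (stE (state n) * 2 ^ n)).
Proof.
  unfold qarg. rewrite scode_snoc, prefix_length, stc_state, !stW_state. f_equal. lia.
Qed.

End Construction.

(** * Comparison of r with mu_p along y *)

Open Scope R_scope.

Lemma INR_pow2 n : INR (2 ^ n) = 2 ^ n.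
Proof. rewrite pow_INR; reflexivity. Qed.

Lemma pow2_pos n : 0 < 2 ^ n.
Proof. apply pow_lt; lra. Qed.

Lemma half_pow n : (/2) ^ n = / 2 ^ n.
Proof. rewrite pow_inv; reflexivity. Qed.

Lemma stK_bsum b q n : INR (stK (state b q n)) = 2 ^ n * bsum b n.
Proof.
  induction n as [|n IH]; [rewrite stK_0; simpl; lra|].
  rewrite stK_state, plus_INR, mult_INR, IH.
  cbn [bsum]. rewrite half_pow. pose proof (pow2_pos n).
  destruct (b n); simpl; field; lra.
Qed.

(** The value r (y|n) of the rational product measure. *)
Definition ratio b q n : R := INR (stN (state b q n)) / INR (stE (state b q n)).

Lemma ratio_S b q n : (forall x, q x = 0%nat \/ q x = 1%nat) ->
  ratio b q (S n) = ratio b q n * (if ybit b q n then 1 - bsum b n else bsum b n).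
Proof.
  intros Hq. unfold ratio. rewrite stN_state, stE_state, !mult_INR, INR_pow2 by auto.
  pose proof (pow2_pos n). pose proof (lt_INR _ _ (stE_pos b q n)) as HE; simpl in HE.
  pose proof (stK_le b q n).
  destruct (ybit b q n).
  - rewrite minus_INR, INR_pow2, stK_bsum by lia. field; lra.
  - rewrite stK_bsum. field; lra.
Qed.

Lemma qarg_ratio b q n :
  INR (stN (state b q n) * stK (state b q n)) / INR (stE (state b q n) * 2 ^ n) =
  ratio b q n * bsum b n.
Proof.
  rewrite !mult_INR, INR_pow2, stK_bsum. unfold ratio.
  pose proof (pow2_pos n). pose proof (lt_INR _ _ (stE_pos b q n)) as HE; simpl in HE.
  field; lra.
Qed.

Lemma Un_cv_const c : Un_cv (fun _ => c) c.
Proof.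
  intros eps He. exists 0%nat. intros n _. unfold Rdist. rewrite Rminus_diag, Rabs_R0. lra.
Qed.

Lemma half_pow_pos n : 0 < (/2) ^ n.
Proof. apply pow_lt; lra. Qed.

Lemma bsum_le b p n : binary_expansion b p -> bsum b n <= p.
Proof.
  intros H. apply (growing_ineq (bsum b)); auto.
  intros k; simpl. pose proof (half_pow_pos k). destruct (b k); lra.
Qed.

Lemma bsum_nonneg b n : 0 <= bsum b n.
Proof. induction n; simpl; [lra|]. pose proof (half_pow_pos n). destruct (b n); lra. Qed.

Lemma bsum_ge b p n : binary_expansion b p -> p <= bsum b n + (/2) ^ n.
Proof.
  intros H. apply (Rle_cv_lim (Un := bsum b) (Vn := fun _ => bsum b n + (/2) ^ n));
    auto using Un_cv_const.
  assert (Hmono : forall k m, bsum b m <= bsum b (k + m)).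
  { induction k; intros m; simpl; [lra|].
    pose proof (half_pow_pos (k + m)). specialize (IHk m). destruct (b (k + m)%nat); lra. }
  (* Subtracting the remaining tail bound makes the induction close: a new digit adds at most
     [(/2) ^ S (k + n)], which is what the tail bound loses. *)
  assert (Hup : forall k, bsum b (k + n) <= bsum b n + (/2) ^ n - (/2) ^ (k + n)).
  { induction k; simpl; [lra|]. destruct (b (k + n)%nat); pose proof (half_pow_pos (k + n)); lra. }
  intros m. destruct (Nat.le_ge_cases m n) as [Hmn|Hmn].
  - pose proof (Hmono (n - m)%nat m) as Hm. replace (n - m + m)%nat with n in Hm by lia.
    pose proof (half_pow_pos n). lra.
  - pose proof (Hup (m - n)%nat) as Hm. replace (m - n + n)%nat with m in Hm by lia.
    pose proof (half_pow_pos m). lra.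
Qed.

Lemma mu_snoc p s c : mu p (s ++ [c]) = mu p s * (if c then 1 - p else p).
Proof.
  unfold mu.
  assert (H0 : count0 (s ++ [c]) = (count0 s + if c then 0 else 1)%nat)
    by (induction s as [|a s IH]; simpl; [|rewrite IH; destruct a]; destruct c; simpl; lia).
  assert (H1 : count1 (s ++ [c]) = (count1 s + if c then 1 else 0)%nat)
    by (clear H0; induction s as [|a s IH]; simpl; [|rewrite IH; destruct a]; destruct c; simpl; lia).
  rewrite H0, H1, !pow_add. destruct c; simpl; ring.
Qed.

Lemma mu_pos p s : 0 < p < 1 -> 0 < mu p s.
Proof. intros Hp. apply Rmult_lt_0_compat; apply pow_lt; lra. Qed.

(* The error of p_n contributes a factor at most exp (2^-n / (1 - p)), and these factors multiply up
   to at most exp (2 / (1 - p)). *)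
Lemma ratio_le_mu b q p n : (forall x, q x = 0%nat \/ q x = 1%nat) ->
  0 < p < 1 -> binary_expansion b p ->
  0 <= ratio b q n <= exp ((2 - 2 * (/2) ^ n) / (1 - p)) * mu p (prefix (ybit b q) n).
Proof.
  intros Hq Hp Hb. induction n as [|n IH].
  - unfold ratio. rewrite stN_0, stE_0. unfold mu. simpl.
    replace ((2 - 2 * 1) / (1 - p)) with 0 by (field; lra). rewrite exp_0. lra.
  - rewrite ratio_S by auto. rewrite prefix_S, mu_snoc.
    set (r := ratio b q n) in *. set (m := mu p (prefix (ybit b q) n)) in *.
    pose proof (bsum_le b p n Hb) as Hle. pose proof (bsum_ge b p n Hb) as Hge.
    pose proof (bsum_nonneg b n) as H0. pose proof (half_pow_pos n) as Hh.
    set (h := (/2) ^ n) in *.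
    replace ((2 - 2 * (/ 2) ^ S n) / (1 - p)) with ((2 - 2 * h) / (1 - p) + h / (1 - p))
      by (unfold h; simpl; field; lra).
    rewrite exp_plus. set (e := exp ((2 - 2 * h) / (1 - p))) in *.
    assert (Hd : 0 <= h / (1 - p)) by (apply Rle_mult_inv_pos; lra).
    pose proof (exp_ineq1_le (h / (1 - p))) as He.
    set (e' := exp (h / (1 - p))) in *.
    (* Truncation gives p_n <= p, so the factor p_n is harmless. Only 1 - p_n can be too large, by
       at most [h], and 1 + x <= exp x absorbs this. *)
    assert (Hf : 0 <= (if ybit b q n then 1 - bsum b n else bsum b n) <=
                 e' * (if ybit b q n then 1 - p else p)).
    { destruct (ybit b q n).
      - split; [lra|]. apply Rle_trans with ((1 + h / (1 - p)) * (1 - p)).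
        + replace ((1 + h / (1 - p)) * (1 - p)) with (1 - p + h) by (field; lra). lra.
        + apply Rmult_le_compat_r; lra.
      - split; [lra|]. nra. }
    split; [apply Rmult_le_pos; lra|].
    replace (e * e' * (m * (if ybit b q n then 1 - p else p))) with
      ((e * m) * (e' * (if ybit b q n then 1 - p else p))) by ring.
    apply Rmult_le_compat; lra.
Qed.

(** * Deciding strict lower bounds on M *)

Definition query_spec (M : bstring -> R) (q : nat -> nat) : Prop :=
  (forall x, q x = 0%nat \/ q x = 1%nat) /\
  forall s num den, (0 < den)%nat ->
    (q (cpair (scode s) (cpair num den)) = 1%nat <-> INR num / INR den < M s).

Lemma M_le_ratio b M q n : semimeasure M -> query_spec M q ->
  M (prefix (ybit b q) n) <= ratio b q n.
Proof.
  intros (_ & H1 & Hadd) [Hq Hspec]. induction n as [|n IH].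
  - unfold ratio. rewrite stN_0, stE_0. change (prefix _ 0) with (@nil bool). simpl. lra.
  - rewrite prefix_S, ratio_S by auto.
    specialize (Hadd (prefix (ybit b q) n)).
    specialize (Hspec (prefix (ybit b q) n ++ [false])
      (stN (state b q n) * stK (state b q n))%nat (stE (state b q n) * 2 ^ n)%nat).
    rewrite <- qarg_state, qarg_ratio in Hspec by auto.
    assert (Hden : (0 < stE (state b q n) * 2 ^ n)%nat).
    { apply Nat.mul_pos_pos; [apply stE_pos|]. pose proof (Nat.pow_nonzero 2 n); lia. }
    specialize (Hspec Hden).
    destruct (ybit b q n) eqn:Ey; unfold ybit in Ey.
    (* Here M (s0) > r (s0), hence M (s1) <= M s - M (s0) < r s - r (s0) = r (s1). *)
    + apply Nat.eqb_eq, Hspec in Ey. nra.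
    + apply Nat.eqb_neq in Ey. apply Rnot_lt_le. intros Hlt. apply Ey, Hspec, Hlt.
Qed.

(** The comparison becomes the vanishing of an arithmetical function, the form needed for
    [Comp_search]. The first summand is the parity of [a]: odd codes are negative numerators and
    cannot exceed a nonnegative fraction. The second vanishes when the cross-multiplied strict
    inequality holds. *)
Lemma qval_gt a e num den : (0 < den)%nat ->
  INR num / INR den < qval a e <->
  ((a - 2 * (a / 2)) + (S (num * S e) - a / 2 * den) = 0)%nat.
Proof.
  intros Hden. unfold qval, zigzag.
  assert (Hd : 0 < INR den) by (apply lt_0_INR; auto).
  assert (He : 0 < INR (S e)) by (apply lt_0_INR; lia).
  assert (Hn : 0 <= INR num / INR den) by (apply Rle_mult_inv_pos; auto; apply pos_INR).
  pose proof (Nat.div_mod_eq a 2) as Ha.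
  assert (Heven : Nat.even a = true <-> (a mod 2 = 0)%nat).
  { rewrite Nat.even_spec. split.
    - intros [k ->]. rewrite Nat.mul_comm. apply Nat.Div0.mod_mul.
    - intros Hm. exists (a / 2)%nat. lia. }
  destruct (Nat.even a).
  - assert (Hm : (a mod 2 = 0)%nat) by (apply Heven; auto).
    assert (E : INR num / INR den < INR (a / 2) / INR (S e) <->
                (num * S e < a / 2 * den)%nat).
    { split; intros H.
      - apply INR_lt. rewrite !mult_INR.
        apply (Rmult_lt_compat_r (INR den * INR (S e))) in H; [|apply Rmult_lt_0_compat; auto].
        replace (INR num / INR den * (INR den * INR (S e))) with (INR num * INR (S e)) in H
          by (field; lra).
        replace (INR (a / 2) / INR (S e) * (INR den * INR (S e))) with (INR (a / 2) * INR den) in H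
          by (field; lra). exact H.
      - apply lt_INR in H. rewrite !mult_INR in H.
        apply (Rmult_lt_reg_r (INR den * INR (S e))); [apply Rmult_lt_0_compat; auto|].
        replace (INR num / INR den * (INR den * INR (S e))) with (INR num * INR (S e))
          by (field; lra).
        replace (INR (a / 2) / INR (S e) * (INR den * INR (S e))) with (INR (a / 2) * INR den)
          by (field; lra). exact H. }
    rewrite E. lia.
  - assert (Hm : (a mod 2 <> 0)%nat) by (intros Hm; apply Heven in Hm; discriminate).
    split; intros H; [exfalso|lia].
    assert (0 <= INR (S a / 2) / INR (S e)) by (apply Rle_mult_inv_pos; auto; apply pos_INR).
    unfold Rdiv in *. lra.
Qed.

(** An oracle-free search for a stage [t] whose approximation exceeds the given fraction halts
    exactly when M does, because the approximations increase to M. The program [D] decides this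
    halting question from [b]. *)
Lemma query_exists b M : halting_le_T b -> left_ce M ->
  exists q, Comp b q /\ query_spec M q.
Proof.
  intros [D HD] (P & a & e & HP & Hmono & Hlim).
  pose (v := fun z => cpair (a (sdec (pfst (pfst z))) (psnd z)) (e (sdec (pfst (pfst z))) (psnd z))).
  assert (Hv : Comp empty_oracle v).
  { apply (Comp_comp_rel empty_oracle P (fun z => cpair (pfst (pfst z)) (psnd z))); [comp|].
    intros z. pose proof (HP (sdec (pfst (pfst z))) (psnd z)) as H.
    rewrite scode_sdec in H. exact H. }
  pose (g := fun z => ((pfst (v z) - 2 * (pfst (v z) / 2)) +
    (S (pfst (psnd (pfst z)) * S (psnd (v z))) - pfst (v z) / 2 * psnd (psnd (pfst z))))%nat).
  assert (Hg : Comp empty_oracle g) by (unfold g; comp; exact Hv).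
  destruct (Comp_search empty_oracle g Hg) as [Q HQ].
  pose (q := fun x => if excluded_middle_informative (halts Q empty_oracle x) then 1%nat else 0%nat).
  exists q. split; [|split].
  - apply (Comp_comp_rel b D (fun x => cpair (enc_prog Q) x)); [comp|].
    intros x. unfold q. destruct (excluded_middle_informative _) as [Hh|Hh]; apply HD; auto.
  - intros x. unfold q. destruct (excluded_middle_informative _); auto.
  - intros s num den Hden.
    assert (Hgs : forall t, g (cpair (cpair (scode s) (cpair num den)) t) = 0%nat <->
                  INR num / INR den < qval (a s t) (e s t)).
    { intros t. unfold g, v. rewrite !psnd_cpair, !pfst_cpair, !psnd_cpair, !pfst_cpair, sdec_scode.
      symmetry. apply qval_gt; auto. }
    transitivity (exists t, INR num / INR den < qval (a s t) (e s t)).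
    + unfold q. destruct (excluded_middle_informative _) as [Hh|Hh]; rewrite HQ in Hh.
      * split; auto. intros _. destruct Hh as [t Ht]. exists t. apply Hgs; auto.
      * split; [discriminate|]. intros [t Ht]. exfalso; apply Hh. exists t. apply Hgs; auto.
    + assert (Hle : forall t, qval (a s t) (e s t) <= M s)
        by (intros t; apply (growing_ineq (fun t => qval (a s t) (e s t)));
            [intros k; apply Hmono | apply Hlim]).
      split.
      * intros [t Ht]. specialize (Hle t). lra.
      (* The gap between M and the fraction serves as epsilon, so some approximation already lies
         above the fraction. *)
      * intros Hlt. destruct (Hlim s (M s - INR num / INR den)) as [N HN]; [lra|].
        exists N. specialize (HN N (le_n N)). unfold Rdist in HN.
        apply Rabs_def2 in HN. lra.
Qed.

(** * Positivity of M *)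

Definition code_weight (s : bstring) : R := / (INR (S (scode s)) * INR (S (scode s))).

(** With [k] the code plus one and [L] = 2^|s|, the children have [k + L] and [k + 2 * L] in place
    of [k]. Since [k <= 2 * L], their weights are at most 4/9 and 1/4 of that of the parent, and 4/9
    + 1/4 < 1. *)
Lemma code_weight_semimeasure : semimeasure code_weight.
Proof.
  assert (H1 : forall s, 1 <= INR (S (scode s)))
    by (intros s; rewrite S_INR; pose proof (pos_INR (scode s)); lra).
  assert (Hb : forall s, 0 <= code_weight s <= 1).
  { intros s. unfold code_weight. specialize (H1 s).
    assert (1 <= INR (S (scode s)) * INR (S (scode s))) by nra.
    split; [left; apply Rinv_0_lt_compat; lra|].
    rewrite <- Rinv_1. apply Rinv_le_contravar; lra. }
  split; [exact Hb|]. split; [apply Hb|].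
  intros s. unfold code_weight. rewrite !scode_snoc.
  specialize (H1 s). pose proof (scode_bound s) as Hs.
  apply le_INR in Hs. rewrite plus_INR, mult_INR in Hs. simpl (INR 2) in Hs.
  set (L := INR (2 ^ length s)) in *.
  replace (INR (S (scode s + 2 ^ length s * (1 + 0)))) with (INR (S (scode s)) + L)
    by (unfold L; rewrite <- plus_INR; f_equal; lia).
  replace (INR (S (scode s + 2 ^ length s * (1 + 1)))) with (INR (S (scode s)) + 2 * L)
    by (unfold L; replace 2 with (INR 2) by reflexivity;
        rewrite <- mult_INR, <- plus_INR; f_equal; lia).
  rewrite S_INR in *. set (c := INR (scode s)) in *. set (k := c + 1) in *.
  assert (Hk : k <= 2 * L) by (unfold k; lra).
  assert (E1 : / ((k + L) * (k + L)) <= 4 / 9 * / (k * k)).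
  { replace (4 / 9 * / (k * k)) with (/ ((3 / 2 * k) * (3 / 2 * k))) by (field; lra).
    apply Rinv_le_contravar; nra. }
  assert (E2 : / ((k + 2 * L) * (k + 2 * L)) <= 1 / 4 * / (k * k)).
  { replace (1 / 4 * / (k * k)) with (/ ((2 * k) * (2 * k))) by (field; lra).
    apply Rinv_le_contravar; nra. }
  assert (0 < / (k * k)) by (apply Rinv_0_lt_compat; nra). lra.
Qed.

Lemma code_weight_left_ce : left_ce code_weight.
Proof.
  assert (H : Comp empty_oracle (fun z => cpair 2 (pfst z * pfst z + 2 * pfst z))) by comp.
  destruct H as [P HP].
  (* The approximation is constant. The code 2 is the zigzag code of numerator 1, and the
     denominator is stored less one: (c + 1)^2 - 1 = c^2 + 2c. *)
  exists P, (fun _ _ => 2%nat), (fun s _ => (scode s * scode s + 2 * scode s)%nat).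
  assert (E : forall s, qval 2 (scode s * scode s + 2 * scode s) = code_weight s).
  { intros s. unfold qval, code_weight, zigzag. rewrite <- mult_INR.
    replace (S (scode s) * S (scode s))%nat with (S (scode s * scode s + 2 * scode s)) by lia.
    simpl. unfold Rdiv. rewrite Rmult_1_l. reflexivity. }
  repeat split.
  - intros s t. specialize (HP (cpair (scode s) t)). cbn beta in HP.
    rewrite pfst_cpair in HP. exact HP.
  - intros; lra.
  - intros s. rewrite E. apply Un_cv_const.
Qed.

Lemma universal_pos M s : universal_lce_semimeasure M -> 0 < M s.
Proof.
  intros (_ & _ & HU). destruct (HU code_weight code_weight_semimeasure code_weight_left_ce) as (c & Hc & H).
  specialize (H s). assert (0 < code_weight s); [|nra].
  apply Rinv_0_lt_compat. rewrite S_INR. pose proof (pos_INR (scode s)). nra.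
Qed.

(** * The Martin-Löf test that captures y *)

Lemma not_MLR_of_Comp p b y d : 0 <= p <= 1 ->
  Comp b (fun n => scode (prefix y n)) ->
  (forall n, mu p (prefix y (d * n)) <= (/2) ^ n) -> ~ MLR p b y.
Proof.
  intros Hp Hy Hmu HMLR. apply HMLR.
  assert (Hyd : Comp b (fun z => scode (prefix y (d * pfst (pfst z)))))
    by (apply (Comp_comp b (fun z => d * pfst (pfst z))%nat (fun n => scode (prefix y n))); [comp|auto]).
  (* The sum of the two truncated differences is zero exactly when the codes agree; it does not
     depend on the stage, so the search succeeds at once or never. *)
  destruct (Comp_search b (fun z => (psnd (pfst z) - scode (prefix y (d * pfst (pfst z)))) +
    (scode (prefix y (d * pfst (pfst z))) - psnd (pfst z)))%nat) as [Q HQ]; [comp; exact Hyd|].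
  assert (Htest : forall n s, test_set Q b n s <-> s = prefix y (d * n)).
  { intros n s. unfold test_set. rewrite HQ. split.
    - intros [t Ht]. rewrite pfst_cpair, psnd_cpair, pfst_cpair in Ht.
      apply scode_inj. lia.
    - intros ->. exists 0%nat. rewrite pfst_cpair, psnd_cpair, pfst_cpair. lia. }
  exists Q. split.
  - intros n F Hinc HF. destruct F as [|s [|s' F]]; simpl.
    + left; apply half_pow_pos.
    + specialize (HF s (or_introl eq_refl)). apply Htest in HF. subst.
      rewrite Rplus_0_r. apply Hmu.
    (* Two entries of the list would both be the single element of U_n, and a string is comparable
       with itself. *)
    + exfalso. inversion Hinc as [|? ? Hall _]; subst. inversion Hall as [|? ? [Hi _] _]; subst.
      apply Hi. exists []. rewrite app_nil_r.
      assert (E1 : s = prefix y (d * n)) by (apply Htest, HF; simpl; auto).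
      assert (E2 : s' = prefix y (d * n)) by (apply Htest, HF; simpl; auto).
      congruence.
  - intros n. exists (d * n)%nat. apply Htest; auto.
Qed.

(** Each bit multiplies the measure by at most max (p, 1 - p) < 1, and [d] is taken so large that
    the [d]-th power of this number is below 1/2. *)
Lemma mu_rate p : 0 < p < 1 -> exists d, forall y n, mu p (prefix y (d * n)) <= (/2) ^ n.
Proof.
  intros Hp. set (q := Rmax p (1 - p)).
  assert (Hq : p <= q /\ 1 - p <= q /\ 0 < q < 1)
    by (unfold q, Rmax; destruct (Rle_dec p (1 - p)); lra).
  destruct (pow_lt_1_zero q) with (y := /2) as [d Hd]; [rewrite Rabs_right; lra|lra|].
  specialize (Hd d (le_n d)).
  assert (Hqd : 0 <= q ^ d) by (apply pow_le; lra).
  rewrite Rabs_right in Hd by lra.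
  exists d. intros y n.
  assert (H : forall k, mu p (prefix y k) <= q ^ k).
  { induction k as [|k IH]; [unfold mu; simpl; lra|].
    rewrite prefix_S, mu_snoc. simpl. rewrite (Rmult_comm q).
    pose proof (mu_pos p (prefix y k) Hp).
    apply Rmult_le_compat; try lra; destruct (y k); lra. }
  eapply Rle_trans; [apply H|]. rewrite pow_mult. apply pow_incr. lra.
Qed.

(** * Logarithms and the case of a null bit *)

Lemma ln_0 : ln 0 = 0.
Proof. unfold ln. destruct (Rlt_dec 0 0) as [H|H]; [destruct (Rlt_irrefl 0 H)|reflexivity]. Qed.

Lemma ln2_pos : 0 < ln 2.
Proof. pose proof ln_lt_2; lra. Qed.

Lemma log2_nonpos x : 0 <= x <= 1 -> log2 x <= 0.
Proof.
  intros Hx. unfold log2.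
  assert (ln x <= 0).
  { destruct (Req_dec x 0) as [->|]; [rewrite ln_0; lra|].
    rewrite <- ln_1. destruct (Req_dec x 1) as [->|]; [lra|]. left; apply ln_increasing; lra. }
  pose proof (Rinv_0_lt_compat _ ln2_pos). unfold Rdiv. nra.
Qed.

(** The bit [v] has probability 0, so its constant sequence has null prefixes from length 1 on and
    [d] = 1 gives a test. The logarithm of the measure is 0 at every length, by [ln_1] for the empty
    prefix and by [ln_0] otherwise, while M <= 1 makes [KA] nonnegative; so c = 0 works. *)
Lemma degenerate_case p v b M : 0 <= p <= 1 -> (if v : bool then 1 - p else p) = 0 ->
  semimeasure M ->
  exists y, ~ MLR p b y /\ exists c, forall n, KA M (prefix y n) >= - log2 (mu p (prefix y n)) - c.
Proof.
  intros Hp Hv (HM & _). exists (fun _ => v).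
  assert (H0 : forall n, mu p (prefix (fun _ => v) (S n)) = 0)
    by (intros n; rewrite prefix_S, mu_snoc, Hv; ring).
  assert (H1 : mu p (prefix (fun _ => v) 0) = 1) by (unfold mu; simpl; ring).
  split.
  - apply (not_MLR_of_Comp p b _ 1); auto.
    + apply (Comp_ext b (fun n => Nat.iter n (fun c => 2 * c + 1 + (if v then 1 else 0))%nat 0%nat)).
      * apply (Comp_iter b (fun n => n)); comp.
      * unfold prefix. intros n.
        assert (E : forall k m, scode (map (fun _ => v) (seq m k)) =
                  Nat.iter k (fun c => 2 * c + 1 + (if v then 1 else 0))%nat 0%nat).
        { induction k as [|k IH]; intros m; cbn [seq map scode Nat.iter]; auto.
          rewrite IH. reflexivity. }
        symmetry; apply E.
    + intros [|n].
      * rewrite Nat.mul_0_r, H1. simpl; lra.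
      * rewrite Nat.mul_1_l, H0. left; apply half_pow_pos.
  - exists 0. intros n. unfold KA.
    assert (log2 (mu p (prefix (fun _ => v) n)) = 0).
    { unfold log2. destruct n; [rewrite H1, ln_1|rewrite H0, ln_0]; unfold Rdiv; ring. }
    pose proof (log2_nonpos _ (HM (prefix (fun _ => v) n))). lra.
Qed.

Theorem mainTheorem16 :
  forall (p : R) (b : nat -> bool),
    0 <= p <= 1 ->
    binary_expansion b p ->
    halting_le_T b ->
    forall M : bstring -> R, universal_lce_semimeasure M ->
    exists y : nat -> bool,
      ~ MLR p b y /\
      exists c : R, forall n : nat,
        KA M (prefix y n) >= - log2 (mu p (prefix y n)) - c.
Proof.
  intros p b Hp Hb HT M HM. pose proof HM as (HMs & HMl & _).
  destruct (Req_dec p 0) as [H0|H0]; [apply (degenerate_case p false); auto|].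
  destruct (Req_dec p 1) as [H1|H1]; [apply (degenerate_case p true); auto; lra|].
  assert (Hp' : 0 < p < 1) by lra.
  destruct (query_exists b M HT HMl) as (q & Hq & Hspec).
  pose proof Hspec as [Hq01 _].
  exists (ybit b q). split.
  - destruct (mu_rate p Hp') as [d Hd]. apply (not_MLR_of_Comp p b _ d); auto.
    apply (Comp_ext b (fun n => stc (state b q n))).
    + apply Comp_state_code; auto.
    + intros n. apply stc_state; auto.
  (* This is the binary logarithm of exp (2 / (1 - p)), the constant by which mu_p is multiplied to
     dominate M along y. *)
  - exists (2 / (1 - p) / ln 2). intros n. unfold KA, log2.
    set (s := prefix (ybit b q) n).
    pose proof (universal_pos M s HM) as HMpos. pose proof (mu_pos p s Hp') as Hmu.
    assert (Hle : M s <= exp (2 / (1 - p)) * mu p s).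
    { eapply Rle_trans; [apply (M_le_ratio b M q n); auto|].
      eapply Rle_trans; [apply (ratio_le_mu b q p n); auto|].
      apply Rmult_le_compat_r; [lra|]. apply Rlt_le, exp_increasing.
      apply Rmult_lt_compat_r; [apply Rinv_0_lt_compat; lra|].
      pose proof (half_pow_pos n). lra. }
    assert (Hln : ln (M s) <= 2 / (1 - p) + ln (mu p s)).
    { rewrite <- (ln_exp (2 / (1 - p))), <- ln_mult; auto using exp_pos.
      destruct Hle as [Hlt| ->]; [left; apply ln_increasing; auto|lra]. }
    pose proof (Rinv_0_lt_compat _ ln2_pos). unfold Rdiv in *. nra.
Qed.
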